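(* Suppose that: ($\aleph$) for every $f:[\aleph_{\omega+1}]^2\to\aleph_\omega$ there is $A\subseteq\aleph_{\omega+1}$ of order type $\omega_1$, stationary in $\sup A$, such that $f''[A]^2$ is countable; and ($\beth$) for every normal $<\omega_1$-type bounded $f:[\omega_1]^2\to\omega_1$ there are an ordinal $\gamma<\omega_1$ and a function $g:\omega_1\to\gamma$ such that $g^{-1}\{i\}$ is $f$-rainbow for every $i<\gamma$. Then $\aleph_{\omega+1}\to^{\mathrm{poly}}(\omega_1\text{-}st)^2_{<\aleph_{\omega+1}\text{-}t\text{-}bdd}$, that is: for every normal $<\aleph_{\omega+1}$-type bounded $f:[\aleph_{\omega+1}]^2\to\aleph_{\omega+1}$ there is an $f$-rainbow set $A\subseteq\aleph_{\omega+1}$ of order type $\omega_1$ which is stationary in $\sup A$.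
   Context: $[C]^2$ is the set of two-element subsets of $C$. A coloring $f$ on $[C]^2$, $C$ a set of ordinals, is normal if $f(a)=f(b)$ implies $\max a=\max b$. A set $A\subseteq C$ is $f$-rainbow if $f\restriction[A]^2$ is one-to-one. For an ordinal $\alpha$, a coloring $f:[\kappa]^2\to\kappa$ is $<\alpha$-type bounded if there is an ordinal $\gamma<\alpha$ such that for all $\eta<\beta<\kappa$ the set $t_{\eta\beta}=\{\xi<\beta: f(\{\xi,\beta\})=f(\{\eta,\beta\})\}$ has order type at most $\gamma$. *)

(* Defs.v *)
From mathcomp Require Import all_boot all_order.
From mathcomp Require Import all_classical.
Set Implicit Arguments.
Unset Strict Implicit.
Unset Printing Implicit Defensive.
Import Order.TTheory.
Local Open Scope card_scope.
Local Open Scope order_scope.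
Local Open Scope classical_set_scope.

(* Ordinals are the elements of a well-ordered type [Ord]; an element [a]
   stands for the ordinal that is the order type of [below a], so that
   [below a] plays the part of the von Neumann ordinal [a].  Well-ordering of
   [Ord] is not needed by the definitions: it is a hypothesis of the theorem,
   stated with [well_order] from wochoice. *)

Section Ordinals.
Context {d : Order.disp_t} {Ord : orderType d}.
Implicit Types (a b c k x y : Ord) (A C X : set Ord).

Definition below a : set Ord := [set x | x < a].

Definition has_order_type A a :=
  exists2 h : Ord -> Ord, set_bij A (below a) h &
    forall x y, A x -> A y -> x < y -> h x < h y.

Definition order_type_le A a := exists2 b, b <= a & has_order_type A b.

Definition is_one a : Prop := below a #= `I_1.

Definition is_omega a :=
  infinite_set (below a) /\ forall x, x < a -> finite_set (below x).

(* a + 1 is the union of a and {a}. *)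
Definition is_succ a b := below b = below a `|` [set a].

(* Cardinals are initial ordinals. *)
Definition is_cardinal k := forall x, x < k -> ~ (below k #<= below x).

Definition is_infinite_cardinal k := infinite_set (below k) /\ is_cardinal k.

(* aleph_a is the infinite cardinal below which the infinite cardinals have
   order type a. *)
Definition is_aleph a k :=
  is_infinite_cardinal k /\
  has_order_type [set x | x < k /\ is_infinite_cardinal x] a.

Definition is_aleph_1 k := exists2 a, is_one a & is_aleph a k.

Definition is_aleph_omega k := exists2 a, is_omega a & is_aleph a k.

Definition is_aleph_omega_succ k :=
  exists a b, [/\ is_omega a, is_succ a b & is_aleph b k].

Definition club a C :=
  [/\ C `<=` below a,
      forall x, x < a -> exists2 y, C y & x <= y
    & forall X y, X `<=` C -> X !=set0 -> supremums X y -> y < a -> C y].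

Definition stationary a A := forall C, club a C -> A `&` C !=set0.

(* The supremum of A is unique when it exists. *)
Definition stationary_in_sup A := exists2 a, supremums A a & stationary a A.

Definition is_max A x := A x /\ ubound A x.

(* [pairs C] is [C]^2. *)
Definition pairs C : set (set Ord) :=
  [set p | exists x y, [/\ C x, C y, x != y & p = [set x; y]]].

(* A coloring of [C]^2 is a total function on sets of ordinals of which only
   the values on [pairs C] are used; "f : [C]^2 -> k" is
   [set_fun (pairs C) (below k) f]. *)
Definition normal C (f : set Ord -> Ord) :=
  forall p q, pairs C p -> pairs C q -> f p = f q ->
  forall x y, is_max p x -> is_max q y -> x = y.

Definition rainbow (f : set Ord -> Ord) A := set_inj (pairs A) f.

Definition type_bounded k a (f : set Ord -> Ord) :=
  exists2 c, c < a & forall y b, y < b -> b < k ->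
    order_type_le [set x | x < b /\ f [set x; b] = f [set y; b]] c.

End Ordinals.

(* Main.v *)
Require Import Defs.
From mathcomp Require Import all_boot all_order.
From mathcomp Require Import all_classical.
From mathcomp Require wochoice.

(** Let [f] be normal and bounded by [c < aleph_(omega+1)].  For [x < y] the
    class [t x y] of all [z < y] with [f {z,y} = f {x,y}] embeds into [c] by
    an increasing map; let [H x y < c] be the image of [x].  On a fixed class
    with top point [y], the map [H _ y] is injective, so a bound on the values
    of [H] is a bound on the classes.  As [c] has at most [aleph_w] elements
    ([aleph_omega_succ_le]), [H] may be read as a colouring of pairs with
    [aleph_w] colours, and the first partition hypothesis yields a set [A] of
    type [omega_1], stationary in its supremum [a], on which [H] takes only
    countably many values.  Countable sets of ordinals have countable order
    types, so the restriction of [f] to [A] is bounded by a countable ordinal.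

    Transporting this restriction to [omega_1] along the increasing
    enumeration of [A] gives a colouring to which the second hypothesis
    applies, provided that its colours are renamed to countable ordinals.
    For each [y] there are only countably many colours [f {x,y}], and
    transfinite recursion renames them with palettes that are disjoint for
    distinct [y] ([disjoint_injections]).  Renaming separately for each [y]
    identifies no new pairs and, as [f] is normal, separates no pairs of the
    same [f]-colour.  Hence [A] is a union of countably many rainbow sets
    ([rainbow_cover]).

    The ordinal [a] has uncountable cofinality ([type_w1_cofinality]), so the
    nonstationary sets are closed under countable unions and one of the
    rainbow pieces is stationary in [a] ([stationary_countable_bigcup]).
    Being stationary it is unbounded in [a], hence uncountable, and an
    uncountable subset of a set of type [omega_1] again has type [omega_1]
    ([stationary_subset_type_w1]). *)

Set Implicit Arguments.
Unset Strict Implicit.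
Unset Printing Implicit Defensive.
Import Order.TTheory.
Local Open Scope order_scope.
Local Open Scope card_scope.
Local Open Scope classical_set_scope.

(** * Cardinality of sets *)

Lemma card_le_injection (T U : Type) (u : U) (A : set T) (B : set U) : A #<= B ->
  exists2 f : T -> U, (forall x, A x -> B (f x)) &
    forall x y, A x -> A y -> f x = f y -> x = y.
Proof.
move=> /card_leP[g].
have /injfunPex[f fAB finj] : $|{injfun A >-> B}| by squash (valLR u g).
by exists f => // x y Ax Ay; apply: finj; exact: mem_set.
Qed.

Lemma injection_card_le (T U : Type) (A : set T) (B : set U) (f : T -> U) :
  (forall x, A x -> B (f x)) ->
  (forall x y, A x -> A y -> f x = f y -> x = y) -> A #<= B.
Proof.
move=> fAB finj; have : $|{injfun A >-> B}|.
  apply/injfunPex; exists f => // x y /set_mem Ax /set_mem Ay; exact: finj.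
by case=> g; exact: inj_card_le.
Qed.

Lemma countableS (T : Type) (A B : set T) : A `<=` B -> countable B -> countable A.
Proof. by move=> AB; apply: sub_countable; exact: subset_card_le. Qed.

Lemma countable_image (T U : Type) (f : T -> U) (A : set T) :
  countable A -> countable (f @` A).
Proof. by apply: sub_countable; exact: card_image_le. Qed.

(** * Recursion, order types and cardinals in a well-ordered type *)

Section WellOrder.
Context {d : Order.disp_t} {Ord : orderType d}.
Hypothesis Ord_wo : wochoice.well_order (<=%O : rel Ord).
Implicit Types (a b c k kw x y z : Ord) (A B C X Y : set Ord).

Lemma ex_least A x : A x -> exists2 m, A m & forall y, A y -> m <= y.
Proof.
move=> Ax.
have [|m [[mA lem] _]] := @Ord_wo (mem A); first by exists x; exact: mem_set.
exists m => [|y Ay]; first exact: set_mem.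
by apply: lem; exact: mem_set.
Qed.

Lemma wf_lt : well_founded (fun x y : Ord => x < y).
Proof.
move=> x; apply: contrapT => nx.
have [m nm mle] := @ex_least [set y | ~ Acc _ y] x nx.
apply: nm; constructor => y ym; apply: contrapT => /mle.
by rewrite leNgt ym.
Qed.

(** Dependent choice along the ordinals: [r y] is chosen from the values of [r]
    below [y].  The first hypothesis lets the relation [P] be stated with total
    functions instead of functions restricted to the predecessors of [y]. *)
Lemma transfinite_choice (T : Type) (t0 : T) (P : Ord -> (Ord -> T) -> T -> Prop) :
  (forall y r r' v, (forall z, z < y -> r z = r' z) -> P y r v -> P y r' v) ->
  (forall y r, exists v, P y r v) ->
  exists r : Ord -> T, forall y, P y r (r y).
Proof.
move=> Pext exP.
have [s sP] := choice (fun p => exP p.1 p.2).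
pose F y (rec : forall z, z < y -> T) : T :=
  s (y, fun z => if pselect (z < y) is left h then rec z h else t0).
pose r := Fix wf_lt (fun=> T) F.
exists r => y.
have -> : r y = F y (fun z _ => r z).
  apply: Fix_eq => x g g' gg'; congr (s (x, _)); apply: funext => z.
  by case: pselect.
apply: Pext (sP (y, _)) => z zy /=.
by case: pselect.
Qed.

Lemma mono_inj A (h : Ord -> Ord) :
  (forall x y, A x -> A y -> x < y -> h x < h y) ->
  forall x y, A x -> A y -> h x = h y -> x = y.
Proof.
move=> hm x y Ax Ay hxy; case: (ltgtP x y) => // lt.
  by have := hm _ _ Ax Ay lt; rewrite hxy ltxx.
by have := hm _ _ Ay Ax lt; rewrite hxy ltxx.
Qed.

(** The witness is the collapse of [A], sending [x] to the least ordinal above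
    the images of the smaller elements of [A].  It is the least increasing map
    on [A], so it lies below [h], which keeps the recursion inside [c]; its
    range has no gaps, so it is an initial segment. *)
Lemma order_type_le_of_mono A c (h : Ord -> Ord) :
  (forall x, A x -> h x < c) ->
  (forall x y, A x -> A y -> x < y -> h x < h y) -> order_type_le A c.
Proof.
move=> hc hm.
(* The strict upper bounds of the values already chosen. *)
pose U y (r : Ord -> Ord) := [set v | forall z, A z -> z < y -> r z < v].
have Uext y r r' : (forall z, z < y -> r z = r' z) -> U y r = U y r'.
  move=> rr'; apply/seteqP; split=> v Uv z Az zy; first by rewrite -rr'// Uv.
  by rewrite rr'// Uv.
have [||r rP] := @transfinite_choice Ord c (fun y r v =>
    U y r !=set0 -> U y r v /\ forall w, U y r w -> v <= w).
- by move=> y r r' v /Uext ->.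
- move=> y r; have [[w /ex_least[m Um mle]]|n] := pselect (U y r !=set0).
    by exists m.
  by exists c.
have rh y : A y -> r y <= h y.
  elim/(well_founded_ind wf_lt): y => y IH Ay.
  have Uh : U y r (h y).
    by move=> z Az zy; exact: le_lt_trans (IH z zy Az) (hm _ _ Az Ay zy).
  by have [|_] := rP y; [exists (h y)|exact].
have UA y : A y -> U y r !=set0.
  move=> Ay; exists (h y) => z Az zy.
  exact: le_lt_trans (rh z Az) (hm _ _ Az Ay zy).
have rm x y : A x -> A y -> x < y -> r x < r y.
  by move=> Ax Ay xy; have [/(_ _ Ax xy)] := rP y (UA y Ay).
have rc : ~ (r @` A) c.
  move=> [y Ay ryc]; have := le_lt_trans (rh y Ay) (hc y Ay).
  by rewrite ryc ltxx.
(* The range turns out to be the set of ordinals below the least missing value. *)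
have [b nb ble] := @ex_least [set v | ~ (r @` A) v] c rc.
exists b; first exact: ble.
exists r => //; split.
- move=> y Ay; rewrite /below /= ltNge; apply/negP => bry.
  have [m [Am bm] mle] := @ex_least [set y | A y /\ b <= r y] y (conj Ay bry).
  have [_ rmle] := rP m (UA m Am).
  have : r m <= b.
    apply: rmle => z Az zm; rewrite ltNge; apply/negP => brz.
    by have := mle z (conj Az brz); rewrite leNgt zm.
  by move=> mb; apply: nb; exists m => //; apply: le_anti; rewrite mb bm.
- move=> x y /set_mem Ax /set_mem Ay; exact: (mono_inj rm).
- move=> v vb; apply: contrapT => /ble.
  by rewrite leNgt; move: vb => /= ->.
Qed.

Lemma ex_cardinal_equiv x : exists m, [/\ m <= x, below x #<= below m & is_cardinal m].
Proof.
have [m xm mle] := @ex_least [set m | below x #<= below m] x (card_lexx _).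
exists m; split=> //; first by apply: mle; exact: card_lexx.
move=> y ym my; have := mle y (card_le_trans xm my).
by rewrite leNgt ym.
Qed.

Lemma below_le x y : x <= y -> below x `<=` below y.
Proof. by move=> xy z /= zx; exact: lt_le_trans zx xy. Qed.

(** Counting predecessors is an injection into the natural numbers. *)
Lemma countable_of_finite_below A :
  (forall x, A x -> finite_set (A `&` below x)) -> countable A.
Proof.
move=> Afin.
have [n nP] : exists n : Ord -> nat, forall x, A x -> A `&` below x #= `I_(n x).
  have [x|n nP] := @choice Ord nat (fun x n => A x -> A `&` below x #= `I_n).
    have [/Afin[n nP]|nAx] := pselect (A x); first by exists n.
    by exists 0%N.
  by exists n.
have nlt x y : A x -> A y -> x < y -> (n x < n y)%N.
  move=> Ax Ay xy; rewrite -card_le_II.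
  have sub : A `&` below x `|` [set x] `<=` A `&` below y.
    move=> z [[Az zx]|->] //=; split=> //; exact: lt_trans zx xy.
  have eqx : A `&` below x `|` [set x] #= `I_(n x).+1.
    apply/eq_cardSP; exists x; first by right.
    have -> : (A `&` below x `|` [set x]) `\ x = A `&` below x.
      apply/seteqP; split=> [z [[]//]|z [Az zx]].
      by split; [left|move=> zEx; move: zx; rewrite zEx /below /= ltxx].
    exact: nP.
  have := subset_card_le sub.
  by rewrite (card_le_eql eqx) (card_le_eqr (nP y Ay)).
apply/countable_injP; exists n => x y /set_mem Ax /set_mem Ay nxy.
case: (ltgtP x y) => // lt.
  by have := nlt _ _ Ax Ay lt; rewrite nxy ltnn.
by have := nlt _ _ Ay Ax lt; rewrite nxy ltnn.
Qed.

Lemma is_one_uniq A a : is_one a -> has_order_type A a ->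
  exists2 w, A w & forall x, A x -> x = w.
Proof.
move=> a1 [h [hf hi hs] _].
have [u ua] : below a !=set0.
  apply/set0P/eqP => a0; have : below a #= `I_1 by [].
  rewrite a0 card_eq_sym card_eq0 => /eqP/seteqP[/(_ 0%N)] /(_ isT).
  by [].
have uE x : below a x -> x = u.
  move=> xa; have : below a #<= `I_1 by move: a1; rewrite /is_one card_eq_le => /andP[].
  move=> /(@card_le_injection _ _ 0%N _ _)[f fI finj]; apply: finj => //.
  by have := fI _ xa; have := fI _ ua; case: (f x) (f u) => [|?] [|?].
have [w Aw _] := hs _ ua; exists w => // x Ax.
by apply: hi; [exact: mem_set..|rewrite (uE _ (hf _ Ax)) (uE _ (hf _ Aw))].
Qed.

(** Some infinite [w] lies below [aleph_1], and a countable set is no larger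
    than [below w], contradicting initiality. *)
Lemma aleph_1_uncountable k : is_aleph_1 k -> ~ countable (below k).
Proof.
move=> [a a1 [[_ kcard] kot]] kc.
have [w [wk [winf _]] _] := is_one_uniq a1 kot.
by apply: (kcard w wk); apply: card_le_trans kc _; apply/infiniteP.
Qed.

(** Only one infinite cardinal [w] lies below [aleph_1].  The least ordinal
    with infinitely many predecessors is an infinite cardinal, so it is [w],
    and so is the cardinality of an infinite [x]; all predecessors of [w] are
    therefore finite ordinals. *)
Lemma aleph_1_countable_below k x : is_aleph_1 k -> x < k -> countable (below x).
Proof.
move=> [a a1 [[kinf kcard] kot]] xk.
have [w [wk [winf wcard]] wuniq] := is_one_uniq a1 kot.
have [xfin|xinf] := pselect (finite_set (below x)); first exact: finite_set_countable.
have [m [mx xm mcard]] := ex_cardinal_equiv x.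
have minf : infinite_set (below m) by move=> /(card_le_finite xm).
have mw : m = w by apply: wuniq; split=> //; exact: le_lt_trans mx xk.
have [o oinf ole] := @ex_least [set o | infinite_set (below o)] w winf.
have ofin y : y < o -> finite_set (below y).
  by move=> yo; apply: contrapT => /ole; rewrite leNgt yo.
have ow : o = w.
  apply: wuniq; split; first exact: le_lt_trans (ole _ winf) wk.
  by split=> // y /ofin yfin oy; apply: oinf; exact: card_le_finite oy yfin.
apply: sub_countable xm _; rewrite mw -ow.
by apply: countable_of_finite_below => y yo; apply: finite_setIr; exact: ofin.
Qed.

(** The infinite cardinals below [c] have type [a + 1] with [a] a copy of
    omega.  A cardinal strictly between [kw] and [c] would give [kw] a rank
    below [a], so only finitely many infinite cardinals would lie below [kw]. *)
Lemma infinite_cardinal_le_aleph_omega kw a m c : is_omega a -> is_aleph_omega kw ->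
  has_order_type [set x | x < c /\ is_infinite_cardinal x] m -> is_succ a m ->
  forall x, x < c -> is_infinite_cardinal x -> x <= kw.
Proof.
move=> [_ afin] [o [oinf ofin] [kwic [g [gf gi gs] _]]] [h [hf hi hs] hm] am x xc xic.
rewrite leNgt; apply/negP => kx.
have kc : kw < c := lt_trans kx xc.
have hkx : h kw < h x by apply: hm.
have hxa : h x <= a.
  have : below m (h x) by apply: hf.
  by rewrite am => -[/ltW|->].
have fin : finite_set (below (h kw)) by apply: afin; exact: lt_le_trans hkx hxa.
pose K := [set x | x < kw /\ is_infinite_cardinal x].
apply: oinf; apply: card_le_finite (card_le_finite _ fin) => [|]; first last.
  apply: (@injection_card_le _ _ K (below (h kw)) h).
    by move=> y [yk yic]; apply: hm => //; split=> //; exact: lt_trans yk kc.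
  move=> y z [yk yic] [zk zic] hyz; apply: hi => //; apply: mem_set; split=> //.
    exact: lt_trans yk kc.
  exact: lt_trans zk kc.
apply: card_le_trans (card_image_le g K); exact: subset_card_le.
Qed.

(** The cardinal of [c] is finite or one of the infinite cardinals bounded by
    the previous lemma. *)
Lemma aleph_omega_succ_le kw k c : is_aleph_omega kw -> is_aleph_omega_succ k ->
  c < k -> below c #<= below kw.
Proof.
move=> kwP [a [m [aP am [_ kot]]]] ck.
have [n [nc cn ncard]] := ex_cardinal_equiv c.
suff nk : n <= kw by exact: card_le_trans cn (subset_card_le (below_le nk)).
have /orP[//|kn] := le_total n kw.
refine (infinite_cardinal_le_aleph_omega aP kwP kot am (le_lt_trans nc ck) _).
split=> //; case: kwP => o _ [[kwinf _] _] nfin; apply: kwinf.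
by apply: sub_finite_set nfin; exact: below_le.
Qed.


(** * Stationary sets at ordinals of uncountable cofinality *)

Definition uncountable_cofinality a :=
  forall Y, Y `<=` below a -> countable Y ->
    exists2 z, z < a & forall y, Y y -> y < z.

(** Unboundedness is the point.  Starting from [x], iterate a step [s] that
    jumps above some element of every [C i]; the supremum [u] of the iterates
    is, for every [i], also the supremum of elements of [C i]. *)
Lemma club_countable_bigcap a (I : Type) (D : set I) (C : I -> set Ord) :
  uncountable_cofinality a -> countable D -> (forall i, D i -> club a (C i)) ->
  club a (below a `&` \bigcap_(i in D) C i).
Proof.
move=> acof Dc Cclub; split=> [x []//|x xa|X y XC X0 ysup ya]; last first.
  split=> // i Di; have [_ _ Ccl] := Cclub i Di.
  by apply: Ccl X0 ysup ya => z /XC[_]; exact.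
(* [w (i, z)] is a point of [C i] above [z]. *)
have [w wP] : exists w : I * Ord -> Ord, forall p, D p.1 -> p.2 < a ->
    C p.1 (w p) /\ p.2 <= w p.
  have [p|w wP] := @choice (I * Ord)%type Ord (fun p v => D p.1 -> p.2 < a ->
    C p.1 v /\ p.2 <= v); last by exists w.
  have [[Di pa]|n] := pselect (D p.1 /\ p.2 < a); last by exists x => Di pa; case: n.
  by have [_ /(_ _ pa)[v Cv pv] _] := Cclub _ Di; exists v.
have wa i z : D i -> z < a -> w (i, z) < a.
  by move=> Di za; have [Ca _ _] := Cclub i Di; apply: Ca; apply: (wP (i, z) _ _).1.
(* [s z] bounds the countably many points [w (i, z)]. *)
have [s sP] : exists s : Ord -> Ord, forall z, z < a ->
    s z < a /\ forall i, D i -> w (i, z) < s z.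
  have [z|s sP] := @choice Ord Ord (fun z v => z < a ->
    v < a /\ forall i, D i -> w (i, z) < v); last by exists s.
  have [za|n] := pselect (z < a); last by exists x.
  have [|//|v va vP] := acof ((fun i => w (i, z)) @` D).
  - by move=> _ [i Di <-]; exact: wa.
  - exact: countable_image.
  by exists v => _; split=> // i Di; apply: vP; exists i.
pose e n := iter n s x.
have ea n : e n < a by elim: n => //= n IH; exact: (sP _ IH).1.
have [|//|v va vP] := acof (range e).
- by move=> _ [n _ <-]; exact: ea.
- exact: countable_image.
have [u ue uleast] := @ex_least (ubound (range e)) v (fun y ey => ltW (vP y ey)).
have ua : u < a by exact: le_lt_trans (uleast _ (fun y ey => ltW (vP y ey))) va.
exists u; last by apply: ue; exists 0%N.
split=> // i Di; have [_ _ Ccl] := Cclub i Di.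
apply: (Ccl [set w (i, e n) | n in setT]) => //.
- by move=> _ [n _ <-]; exact: (wP (i, e n) Di (ea n)).1.
- by exists (w (i, e 0%N)), 0%N.
split.
  move=> _ [n _ <-]; apply: (@le_trans _ _ (e n.+1)); last by apply: ue; exists n.+1.
  by apply/ltW; exact: (sP _ (ea n)).2.
move=> t tP; apply: uleast => _ [n _ <-].
apply: (le_trans (wP (i, e n) Di (ea n)).2); apply: tP; by exists n.
Qed.

(** If every [B i] missed a club [C i], the union would miss the intersection of
    the [C i], which is a club. *)
Lemma stationary_countable_bigcup a (I : Type) (D : set I) (B : I -> set Ord) :
  uncountable_cofinality a -> countable D ->
  stationary a (\bigcup_(i in D) B i) -> exists2 i, D i & stationary a (B i).
Proof.
move=> acof Dc Bst; apply: contrapT => nB.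
have [C CP] : exists C : I -> set Ord, forall i, D i ->
    club a (C i) /\ B i `&` C i = set0.
  have [i|C CP] := @choice I (set Ord) (fun i C => D i ->
    club a C /\ B i `&` C = set0); last by exists C.
  have [Di|n] := pselect (D i); last by exists set0.
  apply: contrapT => nC; apply: nB; exists i => // C Cclub.
  by apply/set0P/eqP => BC; apply: nC; exists C.
have [|x [[i Di Bix] [_ /(_ i Di) Cix]]] := Bst (below a `&` \bigcap_(i in D) C i).
  by apply: club_countable_bigcap => // i /CP[].
have [_ BC] := CP i Di.
have : (B i `&` C i) x by [].
by rewrite BC.
Qed.

(** The final segments of [a] are clubs. *)
Lemma stationary_unbounded a A y : stationary a A -> y < a ->
  exists2 x, A x & y <= x < a.
Proof.
move=> Ast ya; have [|x [Ax yxa]] := Ast [set x | y <= x < a]; last by exists x.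
split=> [x /andP[]//|x xa|X z XC [x Xx] [zub _] za].
  by exists (Order.max x y); rewrite /= ?le_max ?lexx ?orbT// gt_max xa ya.
by rewrite /= za andbT (le_trans _ (zub _ Xx))//; have /andP[] := XC _ Xx.
Qed.

(** * Sets of order type omega_1 *)

Section Omega1.
(** The two properties that characterise the first uncountable ordinal. *)
Variable w1 : Ord.
Hypothesis w1_uncountable : ~ countable (below w1).
Hypothesis w1_countable : forall x, x < w1 -> countable (below x).

Lemma lt_w1 x : countable (below x) -> x < w1.
Proof.
move=> xc; rewrite ltNge; apply/negP => w1x; apply: w1_uncountable.
exact: countableS (below_le w1x) xc.
Qed.

(** Regularity of omega_1: an unbounded countable [Y] would write [below w1]
    as a countable union of countable sets. *)
Lemma countable_bounded_w1 Y : Y `<=` below w1 -> countable Y ->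
  exists2 z, z < w1 & forall y, Y y -> y <= z.
Proof.
move=> Yw Yc; apply: contrapT => nz; apply: w1_uncountable.
apply: (countableS (B := \bigcup_(y in Y) below y)).
  move=> z zw; apply: contrapT => nzY; apply: nz; exists z => // y Yy.
  by rewrite leNgt; apply/negP => zy; apply: nzY; exists y.
by apply: bigcup_countable => // y /Yw; exact: w1_countable.
Qed.

Lemma countable_le_w1 x : x < w1 -> countable [set y | y <= x].
Proof.
move=> xw; apply: (countableS (B := below x `|` [set x])).
  by move=> y /=; rewrite le_eqVlt => /orP[/eqP|]; [right|left].
rewrite -bigcup2E; apply: bigcup_countable => // -[|[|i]] _ //=.
  exact: w1_countable.
Qed.

(** The increasing enumeration of [A]. *)
Lemma type_w1_inverse A : has_order_type A w1 -> exists p : Ord -> Ord,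
  [/\ forall x, x < w1 -> A (p x),
      forall x, A x -> exists2 y, y < w1 & p y = x
    & forall x y, x < w1 -> y < w1 -> (p x < p y) = (x < y)].
Proof.
move=> [h [hf hi hs] hm].
have [y|p pP] := @choice Ord Ord (fun y x => y < w1 -> A x /\ h x = y).
  have [yw|n] := pselect (y < w1); last by exists y.
  by have [x Ax hx] := hs y yw; exists x.
have pm x y : x < w1 -> y < w1 -> x < y -> p x < p y.
  move=> xw yw xy; have [Ax hx] := pP _ xw; have [Ay hy] := pP _ yw.
  rewrite ltNge le_eqVlt; apply/negP => /orP[/eqP pxy|yx].
    by move: xy; rewrite -hx -hy pxy ltxx.
  by have := hm _ _ Ay Ax yx; rewrite hx hy => /(lt_trans xy); rewrite ltxx.
exists p; split=> [x /pP[]//|x Ax|x y xw yw].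
  have hw := hf _ Ax; have [Ap hp] := pP _ hw.
  by exists (h x) => //; apply: hi => //; exact: mem_set.
apply/idP/idP; last exact: pm.
case: (ltgtP x y) => // [yx|->]; last by rewrite ltxx.
by have := pm _ _ yw xw yx => /lt_trans /[apply]; rewrite ltxx.
Qed.

(** Points of a countable subset of [below a] are exceeded by elements of [A],
    whose indices are bounded below omega_1. *)
Lemma type_w1_cofinality A a : has_order_type A w1 -> supremums A a ->
  (A `<=` below a) /\ uncountable_cofinality a.
Proof.
move=> At [aub alub]; have [p [pA pS pm]] := type_w1_inverse At.
have ex_gt x : x < w1 -> exists2 z, z < w1 & x < z.
  move=> xw; apply: contrapT => nz; apply: w1_uncountable.
  apply: countableS (countable_le_w1 xw) => z /= zw; rewrite leNgt; apply/negP => xz.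
  by apply: nz; exists z.
have Aa : A `<=` below a.
  move=> _ /pS[x xw <-]; have [z zw xz] := ex_gt x xw.
  by rewrite /below /=; apply: lt_le_trans (aub _ (pA _ zw)); rewrite pm.
split=> // Y Ya Yc.
(* [q y] is the index of an element of [A] above [y]. *)
have [q qP] : exists q : Ord -> Ord, forall y, Y y -> q y < w1 /\ y < p (q y).
  have [y|q qP] := @choice Ord Ord (fun y x => Y y -> x < w1 /\ y < p x).
    have [Yy|n] := pselect (Y y); last by exists y.
    apply: contrapT => nx; have := Ya y Yy; rewrite /below /= ltNge => /negP; apply.
    apply: alub => _ /pS[x xw <-]; rewrite leNgt; apply/negP => yx.
    by apply: nx; exists x.
  by exists q.
have [|//|z zw zP] := @countable_bounded_w1 (q @` Y).
- by move=> _ [y /qP[qw _] <-].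
- exact: countable_image.
exists (p z); first exact/Aa/pA.
move=> y Yy; have [qw yq] := qP y Yy; apply: lt_le_trans yq _.
rewrite leNgt pm// -leNgt; apply: zP; by exists y.
Qed.

(** A stationary [B] is unbounded in [a], so it cannot be countable; its order
    type is at most [w1] and not a countable ordinal. *)
Lemma stationary_subset_type_w1 A B a : has_order_type A w1 -> supremums A a ->
  B `<=` A -> stationary a B -> has_order_type B w1 /\ supremums B a.
Proof.
move=> At Aa BA Bst; have [Alt acof] := type_w1_cofinality At Aa.
have Bunb y : y < a -> exists2 x, B x & y < x.
  move=> ya; have [| |z za zP] := acof [set y].
  - by move=> _ ->.
  - exact: countable1.
  have [x Bx /andP[zx _]] := stationary_unbounded Bst za.
  by exists x => //; apply: lt_le_trans zx; exact: zP.
have Bunc : ~ countable B.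
  move=> Bc; have [|//|z za zP] := acof B; first by move=> x /BA/Alt.
  by have [x /zP xz /ltW] := Bunb z za; rewrite leNgt xz.
split.
  have [h [hf hi hs] hm] := At.
  have [x /BA/hf//|x y /BA Ax /BA Ay|b bw Bb] := @order_type_le_of_mono B w1 h.
    exact: hm.
  suff -> : w1 = b by [].
  apply: le_anti; rewrite bw andbT leNgt; apply/negP => /w1_countable bc.
  have [g [gf gi _] _] := Bb; apply: Bunc; apply: sub_countable bc.
  by apply: (injection_card_le (f := g)) => // x y Bx By; apply: gi; exact: mem_set.
split=> [x /BA|y yub]; first exact: Aa.1.
rewrite leNgt; apply/negP => /Bunb[x /yub]; by rewrite leNgt => /negP.
Qed.

(** By recursion, [F y] is injected into what the countably many countable
    ranges chosen before leave of [below w1]: an infinite set, since [below w1]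
    is uncountable. *)
Lemma disjoint_injections (F : Ord -> set Ord) :
  (forall y, y < w1 -> countable (F y)) ->
  exists u : Ord -> Ord -> Ord,
    [/\ forall y v, y < w1 -> F y v -> u y v < w1,
        forall y v v', y < w1 -> F y v -> F y v' -> u y v = u y v' -> v = v'
      & forall y z v v', y < w1 -> z < w1 -> F y v -> F z v' ->
          u y v = u z v' -> y = z].
Proof.
move=> Fc.
(* The colours still free at stage [y]. *)
pose R y (r : Ord -> Ord -> Ord) := below w1 `\` \bigcup_(z in below y) (r z @` F z).
have [|y r|u uP] := @transfinite_choice _ (@id Ord)
  (fun y r v => y < w1 -> (forall x, F y x -> R y r (v x)) /\
     (forall x x', F y x -> F y x' -> v x = v x' -> x = x')).
- move=> y r r' v rr'; suff -> : R y r = R y r' by [].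
  congr (_ `\` _); apply: eq_bigcupr => z zy; by rewrite rr'.
- have [yw|n] := pselect (y < w1); last by exists id.
  have FR : F y #<= R y r.
    apply: card_le_trans (Fc y yw) _; apply/infiniteP => Rfin; apply: w1_uncountable.
    pose V := \bigcup_(z in below y) (r z @` F z).
    apply: (countableS (B := R y r `|` V)).
      move=> x xw; have [Vx|nVx] := pselect (V x); [by right|by left].
    rewrite -bigcup2E; apply: bigcup_countable => // -[|[|i]] _ //=.
      exact: finite_set_countable.
    apply: bigcup_countable => [|z zy]; first exact: w1_countable.
    by apply: countable_image; apply: Fc; exact: lt_trans zy yw.
  by have [v vR vi] := card_le_injection y FR; exists v.
have uR y v : y < w1 -> F y v -> R y u (u y v).
  by move=> yw Fv; have [/(_ _ Fv)] := uP y yw.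
have udisj y z v v' : z < w1 -> F y v -> F z v' -> y < z -> u y v <> u z v'.
  move=> zw Fv Fv' yz uE; have [_] := uR _ _ zw Fv'; apply.
  by exists y => //; exists v.
exists u; split=> [y v yw /(uR _ _ yw)[]//|y v v' /uP[_]|y z v v' yw zw Fv Fv' uE].
  exact.
case: (ltgtP y z) => // [/(udisj y z v v')|/(udisj z y v' v)] []//.
Qed.

End Omega1.

End WellOrder.

(** * Colorings of unordered pairs *)

Section Coloring.
Context {d : Order.disp_t} {Ord : orderType d}.
Implicit Types (x y : Ord) (C : set Ord) (f : set Ord -> Ord).

Lemma pairsP C p :
  pairs C p <-> exists x y, [/\ C x, C y, x < y & p = [set x; y]].
Proof.
split=> [[x [y [Cx Cy xNy ->]]]|[x [y [Cx Cy xy ->]]]]; last first.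
  by exists x, y; split=> //; rewrite lt_eqF.
have [xy|yx|xE] := ltgtP x y; [by exists x, y|exists y, x|by rewrite xE eqxx in xNy].
by split=> //; rewrite setUC.
Qed.

Lemma pairs_set2 C x y : C x -> C y -> x < y -> pairs C [set x; y].
Proof. by move=> Cx Cy xy; apply/pairsP; exists x, y. Qed.

Lemma is_max_set2 x y : x < y -> is_max [set x; y] y.
Proof. by move=> xy; split=> [|z [->|->]//]; [right|exact: ltW]. Qed.

Lemma is_max_uniq C x y : is_max C x -> is_max C y -> x = y.
Proof. by move=> [Cx xub] [Cy yub]; apply: le_anti; rewrite xub// yub. Qed.

Lemma set2_inj x y x' y' : x < y -> x' < y' ->
  [set x; y] = [set x'; y'] -> x = x' /\ y = y'.
Proof.
move=> xy xy' E.
have yy' : y = y' by apply: is_max_uniq (is_max_set2 xy) _; rewrite E; exact: is_max_set2.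
split=> //; have : [set x'; y'] x by rewrite -E; left.
by case=> // xE; move: xy; rewrite xE -yy' ltxx.
Qed.

(** A coloring is a function of sets, but is easiest to define from the smaller
    and the larger point.  The ordinal [z] is the value at sets that are not
    pairs. *)
Lemma pair_coloring (z : Ord) (G : Ord -> Ord -> Ord) :
  exists g : set Ord -> Ord, forall x y, x < y -> g [set x; y] = G x y.
Proof.
have [p|g gP] := @choice (set Ord) Ord
  (fun p v => forall x y, x < y -> p = [set x; y] -> v = G x y).
  have [[x [y [xy ->]]]|n] := pselect (exists x y, x < y /\ p = [set x; y]).
    exists (G x y) => x' y' xy' E.
    by have [-> ->] := set2_inj xy xy' E.
  by exists z => x y xy pE; case: n; exists x, y.
by exists g => x y xy; exact: gP.
Qed.

Lemma normal_max C f x y x' y' : normal C f -> C x -> C y -> C x' -> C y' ->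
  x < y -> x' < y' -> f [set x; y] = f [set x'; y'] -> y = y'.
Proof.
move=> fn Cx Cy Cx' Cy' xy xy' fE.
by apply: (fn [set x; y] [set x'; y']) => //; solve [exact: pairs_set2|exact: is_max_set2].
Qed.

Lemma rainbow_set2 C f x y x' y' : rainbow f C -> C x -> C y -> C x' -> C y' ->
  x < y -> x' < y' -> f [set x; y] = f [set x'; y'] -> x = x' /\ y = y'.
Proof.
move=> fr Cx Cy Cx' Cy' xy xy' fE; apply: set2_inj => //.
by apply: fr => //; apply/mem_set/pairs_set2.
Qed.

End Coloring.

(** * Transfer to omega_1 *)

Section Rainbow.
Context {d : Order.disp_t} {Ord : orderType d}.
Hypothesis Ord_wo : wochoice.well_order (<=%O : rel Ord).
Variable w1 : Ord.
Hypothesis w1_uncountable : ~ countable (below w1).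
Hypothesis w1_countable : forall x, x < w1 -> countable (below x).
Hypothesis rainbow_cover_w1 : forall f : set Ord -> Ord,
  set_fun (pairs (below w1)) (below w1) f ->
  normal (below w1) f ->
  type_bounded w1 w1 f ->
  exists2 c : Ord, c < w1 &
  exists2 g : Ord -> Ord, set_fun (below w1) (below c) g &
    forall i : Ord, i < c -> rainbow f (below w1 `&` g @^-1` [set i]).

(** [H] witnesses that the classes of [f] on [A] are small: it embeds each class
    increasingly into the countable set [S], hence into one countable ordinal.
    The coloring [g] of [w1] copies [f] along the enumeration [p] of [A], with
    the colours of the pairs with larger point [y] renamed by [u y], so that
    they are countable ordinals and [g] is normal.  Since [f] is normal, a pair
    of equal [f]-colours has a common larger point and so equal [g]-colours. *)
Lemma rainbow_cover (K A S : set Ord) (c : Ord) (f : set Ord -> Ord)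
    (H : Ord -> Ord -> Ord) :
  normal K f -> A `<=` K -> has_order_type A w1 -> S `<=` below c -> countable S ->
  (forall x y, A x -> A y -> x < y -> S (H x y)) ->
  (forall x x' y, A x -> A x' -> A y -> x < x' -> x' < y ->
     f [set x; y] = f [set x'; y] -> H x y < H x' y) ->
  exists (D : set Ord) (B : Ord -> set Ord),
    [/\ countable D, A `<=` \bigcup_(i in D) B i
      & forall i, D i -> B i `<=` A /\ rainbow f (B i)].
Proof.
move=> fn AK At Sc Scnt HS Hm; have [p [pA pS pm]] := type_w1_inverse At.
have [||e _ [s [sf _ ss] sm]] := @order_type_le_of_mono _ _ Ord_wo S c id => //.
have ew : e < w1.
  by apply: lt_w1 => //; apply: countableS ss _; exact: countable_image.
have pK x : x < w1 -> K (p x) by move=> /pA/AK.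
pose F y := [set f [set p x; p y] | x in below y].
have FI x y : x < y -> F y (f [set p x; p y]) by move=> xy; exists x.
have [|u [uw ui ud]] := @disjoint_injections _ _ Ord_wo _ w1_uncountable w1_countable F.
  by move=> y yw; apply: countable_image; exact: w1_countable.
have [g gE] := pair_coloring w1 (fun x y => u y (f [set p x; p y])).
(* Renaming never identifies two colours. *)
have geq x y x' y' : x < y -> y < w1 -> x' < y' -> y' < w1 ->
    g [set x; y] = g [set x'; y'] -> y = y' /\ f [set p x; p y] = f [set p x'; p y'].
  move=> xy yw xy' yw'; rewrite !gE// => uE.
  have yE : y = y' by apply: ud uE => //; exact: FI.
  split=> //; move: uE; rewrite -yE => /ui; apply=> //; apply: FI => //.
  by rewrite yE.
have [|||c' c'w [h hc hr]] := @rainbow_cover_w1 g.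
- move=> _ /pairsP[x [y [xw yw xy ->]]]; rewrite /below /= gE//.
  by apply: uw => //; exact: FI.
- move=> _ _ /pairsP[x [y [xw yw xy ->]]] /pairsP[x' [y' [xw' yw' xy' ->]]].
  move=> /geq[]// yE _ z z' zmax zmax'.
  by rewrite (is_max_uniq zmax (is_max_set2 xy)) (is_max_uniq zmax' (is_max_set2 xy')).
- exists e => // y b yb bw.
  apply: (order_type_le_of_mono Ord_wo (h := fun x => s (H (p x) (p b)))).
    move=> x [xb _]; have xw := lt_trans xb bw.
    by apply: sf; apply: HS; rewrite ?pm//; exact: pA.
  move=> x x' [xb gx] [xb' gx'] xx'.
  have xw := lt_trans xb bw; have xw' := lt_trans xb' bw.
  apply: sm; [by apply: HS; rewrite ?pm//; exact: pA..|].
  apply: Hm; rewrite ?pm//; try exact: pA.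
  by have [//|//|//|//||_] := geq x b x' b; rewrite ?gx ?gx'.
exists (below c'), (fun i => p @` (below w1 `&` h @^-1` [set i])); split.
- exact: w1_countable.
- move=> _ /pS[x xw <-]; exists (h x); first exact: hc.
  by exists x.
- move=> i ic; split=> [_ [x [xw _] <-]|]; first exact: pA.
  move=> q q' /set_mem/pairsP[? [? [[x [xw xi] <-] [y [yw yi] <-] xy ->]]].
  move=> /set_mem/pairsP[? [? [[x' [xw' xi'] <-] [y' [yw' yi'] <-] xy' ->]]] fE.
  have yE : p y = p y' by apply: normal_max fn _ _ _ _ xy xy' fE; exact: pK.
  rewrite !pm// in xy xy'.
  have yy' : y = y'.
    have [yy'|yy'|//] := ltgtP y y'; [have := pm y y' yw yw'|have := pm y' y yw' yw].
      by rewrite yy' yE ltxx.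
    by rewrite yy' yE ltxx.
  subst y'.
  have [-> _ //] : x = x' /\ y = y.
  apply: (rainbow_set2 (hr i ic)) => //.
  by rewrite !gE// fE.
Qed.

End Rainbow.

(** * Rainbow stationary sets below the successor of aleph_omega *)

Theorem corollary3p8 (d : Order.disp_t) (Ord : orderType d)
  (Ord_wo : wochoice.well_order (<=%O : rel Ord))
  (aleph_1 aleph_w aleph_w1 : Ord)
  (aleph_1P : is_aleph_1 aleph_1)
  (aleph_wP : is_aleph_omega aleph_w)
  (aleph_w1P : is_aleph_omega_succ aleph_w1)
  (Aleph : forall f : set Ord -> Ord,
     set_fun (pairs (below aleph_w1)) (below aleph_w) f ->
     exists A : set Ord,
       [/\ A `<=` below aleph_w1,
           has_order_type A aleph_1,
           stationary_in_sup A
         & countable (f @` pairs A)])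
  (Beth : forall f : set Ord -> Ord,
     set_fun (pairs (below aleph_1)) (below aleph_1) f ->
     normal (below aleph_1) f ->
     type_bounded aleph_1 aleph_1 f ->
     exists2 c : Ord, c < aleph_1 &
     exists2 g : Ord -> Ord, set_fun (below aleph_1) (below c) g &
       forall i : Ord, i < c ->
         rainbow f (below aleph_1 `&` g @^-1` [set i])) :
  forall f : set Ord -> Ord,
    set_fun (pairs (below aleph_w1)) (below aleph_w1) f ->
    normal (below aleph_w1) f ->
    type_bounded aleph_w1 aleph_w1 f ->
    exists A : set Ord,
      [/\ A `<=` below aleph_w1,
          rainbow f A,
          has_order_type A aleph_1
        & stationary_in_sup A].
Proof.
have w1_unc := aleph_1_uncountable aleph_1P.
have w1_cnt x := @aleph_1_countable_below _ _ Ord_wo _ x aleph_1P.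
move=> f _ fn [c cw fb].
have [e ew ei] := card_le_injection c (aleph_omega_succ_le Ord_wo aleph_wP aleph_w1P cw).
pose t x y := [set z | z < y /\ f [set z; y] = f [set x; y]].
(* The embedding [I X] depends on the class [X] only, so that two points of
   the same class are compared by the same map. *)
have [I IP] : exists I : set Ord -> Ord -> Ord, forall x y, x < y -> y < aleph_w1 ->
    (forall z, t x y z -> I (t x y) z < c) /\
    (forall z z', t x y z -> t x y z' -> z < z' -> I (t x y) z < I (t x y) z').
  have [X|I IP] := @choice (set Ord) (Ord -> Ord) (fun X h => order_type_le X c ->
      (forall z, X z -> h z < c) /\
      (forall z z', X z -> X z' -> z < z' -> h z < h z')).
    have [[b bc [h [hf _ _] hm]]|n] := pselect (order_type_le X c); last by exists id.
    by exists h => _; split=> // z Xz; apply: lt_le_trans bc; exact: hf.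
  by exists I => x y xy yw; apply: IP; exact: fb.
have txx x y : x < y -> t x y x by [].
pose H x y := I (t x y) x.
have Hc x y : x < y -> y < aleph_w1 -> H x y < c.
  by move=> xy yw; apply: (IP _ _ xy yw).1; exact: txx.
have [g gE] := pair_coloring c (fun x y => e (H x y)).
have [|A [Aw At [a asup ast] gA]] := Aleph g.
  move=> _ /pairsP[x [y [xw yw xy ->]]]; rewrite /below /= gE//.
  by apply: ew; exact: Hc.
(* The values of [H] on [A], recovered from their codes under [e]. *)
pose S := [set z | z < c /\ (g @` pairs A) (e z)].
have Scnt : countable S.
  apply: sub_countable gA; apply: (injection_card_le (f := e)) => [z []//|z z' [zc _] [zc' _]].
  exact: ei.
have [|||D [B [Dc AB BP]]] := @rainbow_cover _ _ Ord_wo _ w1_unc w1_cnt Beth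
    (below aleph_w1) A S c f H fn Aw At _ Scnt.
- by move=> z [].
- move=> x y Ax Ay xy; split; first by apply: Hc => //; exact: Aw.
  by exists [set x; y]; [exact: pairs_set2|rewrite gE].
- move=> x x' y Ax Ax' Ay xx' xy' fE; have xy := lt_trans xx' xy'.
  have tE : t x y = t x' y by rewrite /t fE.
  rewrite /H -tE; apply: (IP _ _ xy (Aw _ Ay)).2 => //.
have [_ acof] := type_w1_cofinality w1_unc w1_cnt At asup.
have [|i Di Bst] := stationary_countable_bigcup Ord_wo acof Dc (a := a) (B := B).
  move=> C /ast[x [Ax Cx]]; exists x; split=> //; exact: AB.
have [BA Br] := BP i Di.
have [Bt Bsup] := stationary_subset_type_w1 Ord_wo w1_unc w1_cnt At asup BA Bst.
by exists (B i); split=> //; [move=> x /BA/Aw|exists a].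
Qed.
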